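(* Let $\mathbb{F}$ be a skew field and $\Phi=(N,E,\varphi)$ a gain graph with gains in the multiplicative group $\mathbb{F}^\times$, with no two links having the same endpoints and equal gain and with at most one half edge at each node. In the coordinatized projective space $\mathbb{P}_N(\mathbb{F})$, let $\hat v$ be the coordinate point of $v\in N$, let $h_\infty$ be the hyperplane $\sum_{v\in N}x_v=0$, and define $\hat e=\hat v$ for a half edge $e$ at $v$, and for a link $e=e_{vw}$, $\hat e$ = the point spanned by $(1-\varphi(e_{vw}))^{-1}(\hat v-\varphi(e_{vw})\hat w)$ if $\varphi(e_{vw})\ne1$, and $\hat e=h_\infty\cap\hat v\hat w$ if $\varphi(e_{vw})=1$. Let $\mathcal{M}[\Phi]=\{\hat e:e\in E\}$ and $\hat N=\{\hat v:v\in N\}$. Then the maps $v\mapsto\hat v$, $e\mapsto\hat e$ give an isomorphism of biased graphs $\langle\Phi\rangle\cong\Omega(\hat N,\mathcal{M}[\Phi])$ and a matroid isomorphism $G(\Phi)\cong M(\mathcal{M}[\Phi])$.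
   Context: $\mathbb{P}_N(\mathbb{F})$ is the projective space whose points are the 1-dimensional subspaces of the left $\mathbb{F}$-vector space with basis indexed by $N$ (scalars multiply on the left); $\hat v$ is the point of the $v$-th unit vector. A gain graph has gains on links with $\varphi(e_{wv})=\varphi(e_{vw})^{-1}$; a circle is balanced if the product of its gains (in a direction of traversal) is $1$; $\langle\Phi\rangle$ is the resulting biased graph. For a set $\hat E$ of points each lying on a line $\hat v\hat w$ ($v\ne w$) or in $\hat N$, $\Omega(\hat N,\hat E)$ is the biased graph with node set $N$, one edge per point of $\hat E$ (a link $vw$ for a point of $\hat v\hat w\setminus\hat N$, a half edge at $v$ for the point $\hat v$), in which a circle $C$ is balanced iff its points lie in a flat disjoint from $\hat N$. $M(\hat E)$ is the matroid of projective dependence on $\hat E$. The frame matroid $G(\Omega)$ of a biased graph $\Omega$ has ground set $E$ and rank function (on finite sets) $\mathrm{rk}\,S=\#N(S)-b(S)$, where $N(S)$ is the set of endpoints of edges of $S$ and $b(S)$ is the number of balanced components of $(N(S),S)$ (a component is balanced if it has no half edge and all its circles are balanced); $G(\Phi):=G(\langle\Phi\rangle)$. *)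

(* Defs.v *)
From HB Require Import structures.
From mathcomp Require Import all_boot all_order all_algebra.
From mathcomp Require Import finmap boolp classical_sets functions cardinality.
From mathcomp Require Import monalg.
Set Implicit Arguments.
Unset Strict Implicit.
Unset Printing Implicit Defensive.
Import GRing.Theory.
Local Open Scope classical_set_scope.
Local Open Scope ring_scope.

(* Graphs, possibly infinite, whose edges are links (two distinct endpoints)
   and half edges (one endpoint).  There are no loops, so an edge is described
   by its set of endpoints. *)
Record graph (VT ET : choiceType) := Graph {
  nodes : set VT;
  edges : set ET;
  ends : ET -> set VT }.

Definition is_half (VT ET : choiceType) (G : graph VT ET) (e : ET) (v : VT) :=
  edges G e /\ ends G e = [set v].

Definition is_link (VT ET : choiceType) (G : graph VT ET)
    (e : ET) (v w : VT) :=
  [/\ edges G e, v <> w & ends G e = [set v; w]].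

Definition graph_axiom (VT ET : choiceType) (G : graph VT ET) :=
  forall e, edges G e ->
    ends G e `<=` nodes G /\
    ((exists v, is_half G e v) \/ (exists v w, is_link G e v w)).

(* The walk u, e_1, v_1, ..., e_k, v_k is given by its initial node u and the
   sequence of steps (e_1, v_1), ..., (e_k, v_k). *)
Fixpoint walk (VT ET : choiceType) (G : graph VT ET) (u : VT)
    (s : seq (ET * VT)) : Prop :=
  if s is (e, v) :: s' then is_link G e u v /\ walk G v s' else True.

Definition path_to (VT ET : choiceType) (G : graph VT ET) (u w : VT)
    (s : seq (ET * VT)) :=
  [/\ walk G u s, last u (unzip2 s) = w & uniq (u :: unzip2 s)].

(* A simple closed walk.  Since links have distinct endpoints it has length
   at least 2; distinctness of the edges matters for length 2 only. *)
Definition traversal (VT ET : choiceType) (G : graph VT ET) (u : VT)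
    (s : seq (ET * VT)) :=
  [/\ walk G u s, s <> [::], last u (unzip2 s) = u,
      uniq (unzip2 s) & uniq (unzip1 s)].

(* A circle is identified with its edge set. *)
Definition circle (VT ET : choiceType) (G : graph VT ET) (C : set ET) :=
  exists u s, traversal G u s /\ C = [set` unzip1 s].

Record bgraph (VT ET : choiceType) := BGraph {
  bg_graph :> graph VT ET;
  balanced : set (set ET) }.

Definition internally_disjoint (VT ET : choiceType) (w : VT)
    (s t : seq (ET * VT)) :=
  (forall v, v \in unzip2 s -> v \in unzip2 t -> v = w) /\
  (forall e, e \in unzip1 s -> e \notin unzip1 t).

(* s1, s2, s3 are three paths from u to w <> u forming a theta graph. *)
Definition theta (VT ET : choiceType) (G : graph VT ET) (u w : VT)
    (s1 s2 s3 : seq (ET * VT)) :=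
  [/\ u <> w,
      [/\ path_to G u w s1, path_to G u w s2 & path_to G u w s3] &
      [/\ internally_disjoint w s1 s2, internally_disjoint w s2 s3 &
          internally_disjoint w s1 s3]].

(* No theta subgraph contains exactly two balanced circles. *)
Definition biased_graph_axiom (VT ET : choiceType) (O : bgraph VT ET) :=
  [/\ graph_axiom O,
      forall C, balanced O C -> circle O C &
      forall u w s1 s2 s3, theta O u w s1 s2 s3 ->
        balanced O [set` unzip1 s1 ++ unzip1 s2] ->
        balanced O [set` unzip1 s2 ++ unzip1 s3] ->
        balanced O [set` unzip1 s1 ++ unzip1 s3]].

Definition biased_graph_iso (VT ET VT' ET' : choiceType)
    (O : bgraph VT ET) (O' : bgraph VT' ET')
    (f : VT -> VT') (g : ET -> ET') :=
  [/\ biased_graph_axiom O /\ biased_graph_axiom O',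
      set_bij (nodes O) (nodes O') f,
      set_bij (edges O) (edges O') g,
      forall e, edges O e -> ends O' (g e) = f @` ends O e &
      forall C, C `<=` edges O -> balanced O C <-> balanced O' (g @` C)].

(* Finitary matroids, given by their rank function on finite sets (rk is only
   meaningful on finite subsets of the ground set). *)
Record rkfun (T : choiceType) := RkFun {
  ground : set T;
  rk : {fset T} -> nat }.

Definition matroid_axiom (T : choiceType) (M : rkfun T) :=
  [/\ forall S : {fset T}, [set` S] `<=` ground M -> (rk M S <= #|` S|)%N,
      forall S S' : {fset T}, [set` S'] `<=` ground M ->
        (S `<=` S')%fset -> (rk M S <= rk M S')%N &
      forall S S' : {fset T}, [set` S] `<=` ground M ->
        [set` S'] `<=` ground M ->
        (rk M (S `|` S')%fset + rk M (S `&` S')%fset <= rk M S + rk M S')%N].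

Definition matroid_iso (T T' : choiceType) (M : rkfun T) (M' : rkfun T')
    (g : T -> T') :=
  [/\ matroid_axiom M /\ matroid_axiom M',
      set_bij (ground M) (ground M') g &
      forall S : {fset T}, [set` S] `<=` ground M ->
        rk M' (g @` S)%fset = rk M S].

Definition node_set (VT ET : choiceType) (G : graph VT ET) (S : {fset ET}) :
    set VT :=
  [set v | exists2 e, e \in S & ends G e v].

Definition conn (VT ET : choiceType) (G : graph VT ET) (S : {fset ET})
    (v w : VT) :=
  exists s, [/\ walk G v s, {subset unzip1 s <= S} & last v (unzip2 s) = w].

(* The node sets of the components of the graph (N(S), S). *)
Definition components (VT ET : choiceType) (G : graph VT ET) (S : {fset ET}) :
    set (set VT) :=
  [set conn G S v | v in node_set G S].

Definition balanced_component (VT ET : choiceType) (O : bgraph VT ET)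
    (S : {fset ET}) (K : set VT) :=
  [/\ components O S K,
      forall e v, e \in S -> is_half O e v -> ~ K v &
      forall C, circle O C -> C `<=` [set` S] ->
        (forall e, C e -> ends O e `<=` K) -> balanced O C].

Definition frame_matroid (VT ET : choiceType) (O : bgraph VT ET) : rkfun ET :=
  RkFun (edges O) (fun S =>
    (#|` fset_set (node_set O S)| -
     #|` fset_set (balanced_component O S)|)%N).

(* For F a skew field, {malg F[N]} is the left vector space with basis N and
   unit vectors << v >>.  The flats of the projective space are its subspaces
   W; the point p lies in W when p `<=` W. *)
Definition subspace (F : unitRingType) (N : choiceType) (W : set {malg F[N]}) :=
  W 0 /\ forall (a : F) x y, W x -> W y -> W (a *: x + y).

Definition pspan (F : unitRingType) (N : choiceType) (A : set {malg F[N]}) :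
    set {malg F[N]} :=
  smallest (@subspace F N) A.

Definition is_point (F : unitRingType) (N : choiceType) (p : set {malg F[N]}) :=
  exists2 x, x != 0 & p = pspan [set x].

Definition pline (F : unitRingType) (N : choiceType) (p q : set {malg F[N]}) :
    set {malg F[N]} :=
  pspan (p `|` q).

Definition proj_indep (F : unitRingType) (N : choiceType)
    (S : {fset set {malg F[N]}}) :=
  forall p, p \in S -> ~ p `<=` pspan (\bigcup_(q in [set` S] `\ p) q).

Definition proj_matroid (F : unitRingType) (N : choiceType)
    (Eh : set (set {malg F[N]})) : rkfun (set {malg F[N]}) :=
  RkFun Eh (fun S => \max_(T <- fpowerset S | `[< proj_indep T >]) #|` T|).

(* The biased graph of a set Eh of points, each of which is in Nh or on a line
   joining two points of Nh.  Its nodes are the points of Nh themselves. *)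
Definition Omega_graph (F : unitRingType) (N : choiceType)
    (Nh Eh : set (set {malg F[N]})) :
    graph (set {malg F[N]}) (set {malg F[N]}) :=
  Graph Nh Eh (fun p => [set v | Nh v /\
    (p = v \/
     ~ Nh p /\ exists w, [/\ Nh w, v <> w & p `<=` pline v w])]).

Definition Omega (F : unitRingType) (N : choiceType)
    (Nh Eh : set (set {malg F[N]})) :
    bgraph (set {malg F[N]}) (set {malg F[N]}) :=
  BGraph (Omega_graph Nh Eh) [set C | circle (Omega_graph Nh Eh) C /\
    exists W, [/\ subspace W, forall v, Nh v -> ~ v `<=` W &
                  forall p, C p -> p `<=` W]].

(* gain Phi e v w is the gain of the link e in the direction from v to w; it is
   meaningful only when e is a link with endpoints v and w. *)
Record gain_graph (F : unitRingType) (N E : choiceType) := GainGraph {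
  gg_ends : E -> set N;
  gain : E -> N -> N -> F;
  gg_axiom : graph_axiom (Graph setT setT gg_ends);
  gain_neq0 : forall e v w, is_link (Graph setT setT gg_ends) e v w ->
    gain e v w != 0;
  gain_inv : forall e v w, is_link (Graph setT setT gg_ends) e v w ->
    gain e w v = (gain e v w)^-1 }.

Definition gg_graph (F : unitRingType) (N E : choiceType)
    (Phi : gain_graph F N E) : graph N E :=
  Graph setT setT (gg_ends Phi).

Fixpoint walk_gain (F : unitRingType) (N E : choiceType)
    (Phi : gain_graph F N E) (u : N) (s : seq (E * N)) : F :=
  if s is (e, v) :: s' then gain Phi e u v * walk_gain Phi v s' else 1.

Definition gg_bgraph (F : unitRingType) (N E : choiceType)
    (Phi : gain_graph F N E) : bgraph N E :=
  BGraph (gg_graph Phi) [set C | exists u s,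
    [/\ traversal (gg_graph Phi) u s, C = [set` unzip1 s] &
        walk_gain Phi u s = 1]].

Definition node_pt (F : unitRingType) (N : choiceType) (v : N) :
    set {malg F[N]} :=
  pspan [set << v >>].
Arguments node_pt F {N} v.

Definition h_infty (F : unitRingType) (N : choiceType) : set {malg F[N]} :=
  [set x | \sum_(v <- msupp x) x@_v = 0].
Arguments h_infty F N : clear implicits.

Definition link_pt (F : unitRingType) (N : choiceType) (v w : N) (a : F) :
    set {malg F[N]} :=
  if a != 1 then pspan [set (1 - a)^-1 *: (<< v >> - a *: << w >>)]
  else h_infty F N `&` pline (node_pt F v) (node_pt F w).

(* For a link the union is over its two orientations, which yield the same
   point: see edge_pt_half and edge_pt_link below. *)
Definition edge_pt (F : unitRingType) (N E : choiceType)
    (Phi : gain_graph F N E) (e : E) : set {malg F[N]} :=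
  [set x | (exists2 v, is_half (gg_graph Phi) e v & node_pt F v x) \/
           (exists v w, is_link (gg_graph Phi) e v w /\
                        link_pt v w (gain Phi e v w) x)].

Definition node_pts (F : unitRingType) (N : choiceType) :
    set (set {malg F[N]}) :=
  range (node_pt F).
Arguments node_pts F N : clear implicits.

Definition edge_pts (F : unitRingType) (N E : choiceType)
    (Phi : gain_graph F N E) : set (set {malg F[N]}) :=
  range (edge_pt Phi).

Lemma pspan_subspace (F : unitRingType) (N : choiceType)
    (A : set {malg F[N]}) : subspace (pspan A).
Proof.
split=> [W [[W0 _] _] //|a x y xA yA W [sW AW]].
by apply: sW.2; [apply: xA|apply: yA].
Qed.

Lemma sub_pspan (F : unitRingType) (N : choiceType) (A : set {malg F[N]}) :
  A `<=` pspan A.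
Proof. by move=> x Ax W [_]; apply. Qed.

Lemma pspan_min (F : unitRingType) (N : choiceType) (A W : set {malg F[N]}) :
  subspace W -> A `<=` W -> pspan A `<=` W.
Proof. by move=> sW AW x; apply. Qed.

Lemma pspan1E (F : unitRingType) (N : choiceType) (x : {malg F[N]}) :
  pspan [set x] = [set c *: x | c in [set: F]].
Proof.
apply/seteqP; split.
  apply: pspan_min => [|_ ->]; last by exists 1; rewrite ?scale1r.
  split=> [|a _ _ [b _ <-] [c _ <-]]; first by exists 0; rewrite ?scale0r.
  by exists (a * b + c); rewrite ?scalerDl ?scalerA.
move=> _ [c _ <-]; have [s0 sD] := pspan_subspace [set x].
by rewrite -[_ *: _]addr0; apply: sD => //; apply: sub_pspan.
Qed.

Lemma pspan1Z (F : unitRingType) (N : choiceType) (c : F) (x : {malg F[N]}) :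
  c \is a GRing.unit -> pspan [set c *: x] = pspan [set x].
Proof.
move=> cU; rewrite !pspan1E; apply/seteqP; split=> _ [b _ <-].
  by exists (b * c); rewrite ?scalerA.
by exists (b / c); rewrite // scalerA divrK.
Qed.

Lemma plineC (F : unitRingType) (N : choiceType) (p q : set {malg F[N]}) :
  pline p q = pline q p.
Proof. by rewrite /pline setUC. Qed.

Lemma pline_node_ptE (F : unitRingType) (N : choiceType) (v w : N) :
  pline (node_pt F v) (node_pt F w) =
  [set x | exists a b, x = a *: << v >> + b *: << w >>].
Proof.
apply/seteqP; split.
  apply: pspan_min.
    split=> [|c _ _ [a [b ->]] [a' [b' ->]]].
      by exists 0, 0; rewrite !scale0r addr0.
    exists (c * a + a'), (c * b + b').
    by rewrite scalerDr !scalerA !scalerDl addrACA.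
  move=> x; rewrite /node_pt !pspan1E => -[] [c _ <-].
    by exists c, 0; rewrite scale0r addr0.
  by exists 0, c; rewrite scale0r add0r.
have [s0 sD] := pspan_subspace (node_pt F v `|` node_pt F w).
move=> _ [a [b ->]]; apply: (sD).
  by apply: sub_pspan; left; apply: sub_pspan.
rewrite -[_ *: _]addr0; apply: (sD) => //.
by apply: sub_pspan; right; apply: sub_pspan.
Qed.

Lemma h_infty_pairE (F : unitRingType) (N : choiceType) (v w : N) (a b : F) :
  v <> w -> h_infty F N (a *: << v >> + b *: << w >>) <-> a + b = 0.
Proof.
move=> /eqP vw; set x := _ + _.
have xE k : x@_k = a *+ (v == k) + b *+ (w == k).
  by rewrite mcoeffD !mcoeffZ !mcoeffU !mulrnAr !mulr1.
rewrite /h_infty /mkset.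
suff -> : \sum_(k <- msupp x) x@_k = a + b by [].
have sub : (msupp x `<=` [fset v; w])%fset.
  apply/fsubsetP => k; rewrite -mcoeff_neq0 xE !inE (eq_sym k v) (eq_sym k w).
  by case: (v == k); case: (w == k) => //=; rewrite !mulr0n addr0 eqxx.
rewrite (big_fset_incl _ sub) /=; last first.
  by move=> k _; rewrite -mcoeff_eq0 => /eqP.
rewrite big_fsetU1 ?inE //= big_seq_fset1 !xE !eqxx.
by rewrite [w == v]eq_sym (negPf vw) !mulr0n addr0 add0r.
Qed.

Lemma link_ptE (F : unitRingType) (N : choiceType) (v w : N) (a : F) :
  (forall x : F, x != 0 -> x \is a GRing.unit) -> v <> w ->
  link_pt v w a = pspan [set << v >> - a *: << w >>].
Proof.
move=> skewF vw; rewrite /link_pt; case: eqP => [->|/eqP a1] /=; last first.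
  by rewrite pspan1Z // unitrV skewF // subr_eq0 eq_sym.
rewrite pline_node_ptE pspan1E scale1r; apply/seteqP; split.
  move=> _ [/[swap] [[b [c ->]]]] /(h_infty_pairE _ _ vw)/eqP.
  rewrite addrC addr_eq0 => /eqP ->.
  by exists b; rewrite // scaleNr scalerBr.
move=> _ [c _ <-]; rewrite scalerBr -scaleNr; split; last by exists c, (- c).
by apply/h_infty_pairE; rewrite ?subrr.
Qed.

Lemma link_ptC (F : unitRingType) (N : choiceType) (v w : N) (a : F) :
  (forall x : F, x != 0 -> x \is a GRing.unit) -> v <> w -> a != 0 ->
  link_pt w v a^-1 = link_pt v w a.
Proof.
move=> skewF vw a0; have aU := skewF _ a0.
rewrite !link_ptE //; last by move=> wv; apply: vw.
rewrite -(@pspan1Z _ _ (- a)) ?unitrN // scaleNr scalerBr scalerA mulrV //.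
by rewrite scale1r opprB.
Qed.

Lemma set1_neq2 (T : choiceType) (u v w : T) :
  v <> w -> [set u] <> [set v; w].
Proof.
move=> vw E; apply: vw; have [vu wu] : [set u] v /\ [set u] w.
  by rewrite E; split; [left|right].
by rewrite vu wu.
Qed.

Lemma set2_eq (T : choiceType) (v w v' w' : T) :
  v' <> w' -> [set v; w] = [set v'; w'] ->
  (v' = v /\ w' = w) \/ (v' = w /\ w' = v).
Proof.
move=> vw' E; have [] : [set v; w] v' /\ [set v; w] w'.
  by rewrite E; split; [left|right].
by case=> [] v'E [] w'E; [case: vw'; rewrite v'E w'E|left|right|
  case: vw'; rewrite v'E w'E].
Qed.

Lemma edge_pt_half (F : unitRingType) (N E : choiceType)
    (Phi : gain_graph F N E) (e : E) (v : N) :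
  is_half (gg_graph Phi) e v -> edge_pt Phi e = node_pt F v.
Proof.
move=> [_ ev]; apply/seteqP; split=> x; last by left; exists v.
case=> [[u [_]]|[u [w [[_ uw]]]]]; rewrite ev.
  by move=> /seteqP[/(_ v erefl) ->].
by move=> /(set1_neq2 uw).
Qed.

Lemma edge_pt_link (F : unitRingType) (N E : choiceType)
    (Phi : gain_graph F N E) (e : E) (v w : N) :
  (forall x : F, x != 0 -> x \is a GRing.unit) ->
  is_link (gg_graph Phi) e v w -> edge_pt Phi e = link_pt v w (gain Phi e v w).
Proof.
move=> skewF evw; have [_ vw eE] := evw; apply/seteqP; split=> x; last first.
  by right; exists v, w.
case=> [[u [_]]|[u [u' [[_ uu']]]]]; rewrite eE.
  by move=> /esym /(set1_neq2 vw).
move=> /(set2_eq uu')[] [-> ->] //.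
by rewrite (gain_inv evw) link_ptC // (gain_neq0 evw).
Qed.

Lemma edge_pt_point (F : unitRingType) (N E : choiceType)
    (Phi : gain_graph F N E) (e : E) :
  (forall x : F, x != 0 -> x \is a GRing.unit) -> is_point (edge_pt Phi e).
Proof.
move=> skewF; have [_ [[v ev]|[v [w evw]]]] := @gg_axiom _ _ _ Phi e I.
  rewrite (edge_pt_half ev); exists << v >> => //.
  by apply/eqP=> /malgP/(_ v)/eqP; rewrite mcoeffU mcoeff0 eqxx oner_eq0.
rewrite (edge_pt_link skewF evw) link_ptE //; last by case: evw.
exists (<< v >> - gain Phi e v w *: << w >>) => //.
have [_ /eqP vw _] := evw.
apply/eqP=> /malgP/(_ v)/eqP; rewrite mcoeffB mcoeffZ !mcoeffU mcoeff0 eqxx.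
by rewrite [w == v]eq_sym (negPf vw) mulr0 subr0 oner_eq0.
Qed.

(* Main.v *)
Require Import Defs.
From HB Require Import structures.
From mathcomp Require Import all_boot all_order all_algebra.
From mathcomp Require Import finmap boolp classical_sets functions cardinality.
From mathcomp Require Import monalg.
Set Implicit Arguments.
Unset Strict Implicit.
Unset Printing Implicit Defensive.
Import GRing.Theory.
Local Open Scope classical_set_scope.
Local Open Scope ring_scope.

(* Call h : N -> F a potential on an edge set when h v = gain e v w * h w for
   its links e.  The functional x |-> \sum_v x_v h_v kills the point of a link e
   exactly when h satisfies the equation of e, while summing the vectors
   << v >> - gain e v w *: << w >> along a walk telescopes.  A circle is
   therefore balanced iff it carries a nowhere zero potential, iff its points
   lie in a flat that avoids the node points (the kernel of the functional).
   For the ranks, a basis of the points of S, completed by one node point for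
   each balanced component, is a basis of the span of the nodes of S:
   the completed set spans since an unbalanced component contains a
   half edge or a circle of gain g <> 1, which gives (1 - g) *: << u >>, and it
   is independent by the functionals of the potentials of the balanced
   components. *)

(** * Span, exchange, bases and rank of finite sets of projective points *)

Section PointMatroid.
Variables (F : unitRingType) (N : choiceType).
Hypothesis skewF : forall x : F, x != 0 -> x \is a GRing.unit.
Implicit Types (p q : set {malg F[N]}) (A B S T : {fset set {malg F[N]}}).
Implicit Types (W : set {malg F[N]}).

Lemma subspaceZ W a x : subspace W -> W x -> W (a *: x).
Proof. by case=> W0 WD Wx; rewrite -[_ *: _]addr0; apply: WD. Qed.

Lemma subspaceD W x y : subspace W -> W x -> W y -> W (x + y).
Proof. by case=> W0 WD Wx Wy; rewrite -[x]scale1r; apply: WD. Qed.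

Lemma subspaceZ_unit W a x :
  subspace W -> a != 0 -> W (a *: x) -> W x.
Proof.
move=> sW a0 Wx; rewrite -[x]scale1r -(mulVr (skewF a0)) -scalerA.
exact: subspaceZ.
Qed.

Lemma pspan1_sub W (x : {malg F[N]}) :
  subspace W -> pspan [set x] `<=` W <-> W x.
Proof.
move=> sW; split=> [|Wx]; first by apply; apply: sub_pspan.
by apply: pspan_min => // _ ->.
Qed.

Definition fspan A : set {malg F[N]} := pspan (\bigcup_(q in [set` A]) q).

Lemma fspan_subspace A : subspace (fspan A).
Proof. exact: pspan_subspace. Qed.

Lemma sub_fspan A p : p \in A -> p `<=` fspan A.
Proof. by move=> pA x px; apply: sub_pspan; exists p. Qed.

Lemma fspan_min A W :
  subspace W -> (forall p, p \in A -> p `<=` W) -> fspan A `<=` W.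
Proof. by move=> sW AW; apply: pspan_min => // x [p pA px]; apply: AW px. Qed.

Lemma fspanS A B : (A `<=` B)%fset -> fspan A `<=` fspan B.
Proof.
move=> /fsubsetP AB; apply: fspan_min; first exact: fspan_subspace.
by move=> p /AB; apply: sub_fspan.
Qed.

Lemma proj_indepP S :
  proj_indep S <-> forall p, p \in S -> ~ p `<=` fspan (S `\ p)%fset.
Proof.
have E p : [set` (S `\ p)%fset] = [set` S] `\ p.
  apply/seteqP; split=> q /=; rewrite !inE; first by case/andP=> /eqP qp qS.
  by case=> qS /eqP qp; rewrite qp.
by rewrite /proj_indep /fspan; split=> H p pS; have := H p pS; rewrite E.
Qed.

Lemma proj_indep_sub A B : (A `<=` B)%fset -> proj_indep B -> proj_indep A.
Proof.
move=> AB /proj_indepP iB; apply/proj_indepP => p pA pAp.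
apply: (iB p); first exact: (fsubsetP AB).
by apply: subset_trans pAp _; apply: fspanS; apply: fsetSD.
Qed.

Lemma proj_indep0 : proj_indep (fset0 : {fset set {malg F[N]}}).
Proof. by apply/proj_indepP => p; rewrite inE. Qed.

(** The vectors of this form already make up a subspace containing every generating point. The
    explicit coefficient [c] is what the exchange property divides by. *)
Lemma fspan1U A y x : fspan (pspan [set y] |` A)%fset x ->
  exists c z, fspan A z /\ x = c *: y + z.
Proof.
move: x; pose W := [set x | exists c z, fspan A z /\ x = c *: y + z].
apply: (@fspan_min _ W).
  split=> [|a _ _ [c [z [Az ->]]] [c' [z' [Az' ->]]]].
    by exists 0, 0; rewrite scale0r addr0; split=> //; case: (fspan_subspace A).
  exists (a * c + c'), (a *: z + z'); split.
    by case: (fspan_subspace A) => _; apply.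
  by rewrite scalerDr !scalerA scalerDl addrACA.
move=> p; rewrite !inE => /orP[/eqP -> x|pA x px].
  rewrite pspan1E => -[c _ <-]; exists c, 0; rewrite addr0; split=> //.
  by case: (fspan_subspace A).
by exists 0, x; rewrite scale0r add0r; split=> //; apply: sub_fspan px.
Qed.

(** If [x] spans [p] and [y] spans [q], then [x = c *: y + z] with [z] in the span of [A]. Here [c]
    is nonzero, since otherwise [p] would lie in that span, so [y] can be solved for. *)
Lemma fspan_exchange A p q : is_point p -> is_point q ->
  p `<=` fspan (q |` A)%fset -> ~ p `<=` fspan A ->
  q `<=` fspan (p |` A)%fset.
Proof.
move=> [x x0 ->] [y y0 ->].
move=> /(pspan1_sub _ (fspan_subspace _)) /fspan1U[c [z [Az xE]]].
move=> /(pspan1_sub _ (fspan_subspace _)) Ax.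
apply/(pspan1_sub _ (fspan_subspace _)).
have c0 : c != 0 by apply/eqP => c0; apply: Ax; rewrite xE c0 scale0r add0r.
apply: (subspaceZ_unit (fspan_subspace _) c0).
have -> : c *: y = x + (-1) *: z by rewrite xE scaleN1r addrK.
apply: (subspaceD (fspan_subspace _)).
  apply: (@sub_fspan _ (pspan [set x])); first by rewrite !inE eqxx.
  exact: sub_pspan.
apply: (subspaceZ _ (fspan_subspace _)).
by apply: fspanS Az; apply: fsubsetUr.
Qed.

(** If an old point fell into the span of the others together with [q], exchange would put [q] into
    the span of [A]. *)
Lemma proj_indep1U A q : is_point q -> (forall p, p \in A -> is_point p) ->
  proj_indep A -> ~ q `<=` fspan A -> proj_indep (q |` A)%fset.
Proof.
move=> ptq ptA /proj_indepP iA qA; apply/proj_indepP => p.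
have qNA : q \notin A by apply/negP => /sub_fspan.
rewrite !inE => /orP[/eqP -> /=|pA].
  by rewrite fsetU1K.
have pq : p != q by apply: contraNneq qNA => <-.
have -> : ((q |` A) `\ p)%fset = (q |` (A `\ p))%fset.
  apply/fsetP => r; rewrite !inE; case: (r =P q) => [->|] //=.
  by rewrite eq_sym pq.
move=> pS; apply: qA; rewrite -(fsetD1K pA).
by apply: fspan_exchange pS (iA _ pA) => //; exact: ptA.
Qed.

(** Steinitz replacement, by induction on the number of points of [A] outside [B]. Such a point [p]
    is replaced by a [q] of [B] outside the span of the rest of [A]; without such a [q], that span
    would contain [B] and hence [p]. *)
Lemma proj_indep_card_le A B :
  (forall p, p \in A -> is_point p) -> (forall p, p \in B -> is_point p) ->
  proj_indep A -> (forall p, p \in A -> p `<=` fspan B) ->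
  (#|` A| <= #|` B|)%N.
Proof.
move=> + ptB; have [n] := ubnP #|` (A `\` B)%fset|.
elim: n A => // n IHn A ltn ptA iA AB.
have [/eqP|[p]] := fset_0Vmem (A `\` B)%fset.
  by rewrite fsetD_eq0; apply: fsubset_leq_card.
rewrite inE => /andP[pB pA].
have [q qB qA] : exists2 q, q \in B & ~ q `<=` fspan (A `\ p)%fset.
  apply: contrapT => H; have /proj_indepP/(_ p pA) := iA; apply.
  apply: (subset_trans (AB p pA)).
  apply: fspan_min; first exact: fspan_subspace.
  by move=> q qB; apply: contrapT => qA; apply: H; exists q.
have qNA : q \notin (A `\ p)%fset by apply/negP => /sub_fspan.
have ptAp r : r \in (A `\ p)%fset -> is_point r.
  by rewrite !inE => /andP[_ /ptA].
have -> : #|` A| = #|` (q |` (A `\ p))%fset|.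
  by rewrite cardfsU1 qNA (cardfsD1 p A) pA.
apply: IHn.
- apply: leq_trans (_ : #|` (A `\` B)%fset| <= _)%N => //.
  rewrite (cardfsD1 p (A `\` B)%fset) inE pB pA /= add1n ltnS.
  apply: fsubset_leq_card; apply/fsubsetP => r; rewrite !inE.
  move=> /andP[rB] /orP[/eqP rq|/andP[-> ->]]; last by rewrite rB.
  by rewrite rq qB in rB.
- by move=> r; rewrite in_fset1U => /orP[/eqP ->|/ptAp //]; apply: ptB.
- apply: proj_indep1U; [exact: ptB|exact: ptAp| |exact: qA].
  by apply: proj_indep_sub iA; apply: fsubD1set.
- move=> r; rewrite in_fset1U => /orP[/eqP ->|]; first exact: sub_fspan.
  by rewrite !inE => /andP[_ /AB].
Qed.

Definition proj_basis T S := [/\ (T `<=` S)%fset, proj_indep T &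
  forall p, p \in S -> p `<=` fspan T].

(** Greedy extension: while some point of [S] lies outside the span, it is added. The induction is
    on the number of points of [S] not yet taken. *)
Lemma proj_basis_ext A S : (forall p, p \in S -> is_point p) ->
  (A `<=` S)%fset -> proj_indep A ->
  exists2 T, proj_basis T S & (A `<=` T)%fset.
Proof.
move=> ptS; have [n] := ubnP #|` (S `\` A)%fset|.
elim: n A => // n IHn A ltn AS iA.
have [H|/existsNP[q /not_implyP[qS qA]]] :=
  pselect (forall p, p \in S -> p `<=` fspan A).
  by exists A.
have qNA : q \notin A by apply/negP => /sub_fspan.
have [|||T bT qAT] := IHn (q |` A)%fset.
- rewrite (cardfsD1 q) !inE qNA qS /= add1n ltnS in ltn.
  by rewrite fsetUC -fsetDDl.
- by rewrite fsubUset fsub1set qS.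
- apply: proj_indep1U => //; first exact: ptS.
  by move=> p /(fsubsetP AS); apply: ptS.
- by exists T => //; apply: fsubset_trans qAT; apply: fsubsetUr.
Qed.

Lemma leq_proj_rk (Eh : set (set {malg F[N]})) T S :
  (T `<=` S)%fset -> proj_indep T -> (#|` T| <= rk (proj_matroid Eh) S)%N.
Proof.
move=> TS iT /=.
by apply: (leq_bigmax_seq (P := fun T => `[< proj_indep T >])) => //;
  [rewrite fpowersetE|apply/asboolP].
Qed.

Lemma proj_rk_leq (Eh : set (set {malg F[N]})) S n :
  (forall T, (T `<=` S)%fset -> proj_indep T -> (#|` T| <= n)%N) ->
  (rk (proj_matroid Eh) S <= n)%N.
Proof.
move=> H; apply/bigmax_leqP_seq => T; rewrite fpowersetE => TS /asboolP /H.
by apply.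
Qed.

Lemma proj_rk_basis (Eh : set (set {malg F[N]})) T S :
  (forall p, p \in S -> is_point p) -> proj_basis T S ->
  rk (proj_matroid Eh) S = #|` T|.
Proof.
move=> ptS [TS iT ST]; apply/eqP; rewrite eqn_leq leq_proj_rk // andbT.
apply: proj_rk_leq => A /fsubsetP AS iA; apply: proj_indep_card_le => //.
- by move=> p /AS /ptS.
- by move=> p /(fsubsetP TS) /ptS.
- by move=> p /AS /ST.
Qed.

(** For submodularity, a basis [A] of the intersection is extended to a basis [B] of [S] and then to
    a basis [D] of the union. *)
Lemma proj_matroid_axiom (Eh : set (set {malg F[N]})) :
  (forall p, Eh p -> is_point p) -> matroid_axiom (proj_matroid Eh).
Proof.
move=> ptE; split=> [S _|S S' _ SS'|S S' SE SE'].
- by apply: proj_rk_leq => T TS _; apply: fsubset_leq_card.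
- apply: proj_rk_leq => T TS iT; apply: leq_proj_rk => //.
  exact: fsubset_trans SS'.
have ptS p : p \in S -> is_point p by move=> pS; apply/ptE/SE.
have ptS' p : p \in S' -> is_point p by move=> pS; apply/ptE/SE'.
have ptI p : p \in (S `&` S')%fset -> is_point p.
  by rewrite inE => /andP[/ptS].
have ptU p : p \in (S `|` S')%fset -> is_point p.
  by rewrite inE => /orP[/ptS|/ptS'].
have [A bA _] := proj_basis_ext ptI (fsub0set _) proj_indep0.
have [AI iA _] := bA.
have [|B bB AB] := proj_basis_ext (S := S) (A := A) ptS _ iA.
  by apply: fsubset_trans AI _; apply: fsubsetIl.
have [BS iB SB] := bB.
have [|D bD BD] := proj_basis_ext (S := (S `|` S')%fset) (A := B) ptU _ iB.
  by apply: fsubset_trans BS _; apply: fsubsetUl.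
have [DU iD _] := bD.
rewrite (proj_rk_basis _ ptI bA) (proj_rk_basis _ ptU bD).
rewrite (proj_rk_basis _ ptS bB).
have AD := fsubset_trans AB BD.
(* A point of [D] outside [B] cannot be in [S], for then it would depend on [B], a part of the rest
   of [D]. *)
have DBS' : (D `\` B `<=` S')%fset.
  apply/fsubsetP => p; rewrite inE => /andP[pB pD].
  have := fsubsetP DU _ pD; rewrite inE => /orP[pS|//].
  have /proj_indepP/(_ p pD)[] := iD.
  apply: (subset_trans (SB _ pS)); apply: fspanS; apply/fsubsetP => q qB.
  by rewrite !inE (fsubsetP BD) // andbT; apply: contraNneq pB => <-.
have AS' : (A `<=` S')%fset by apply: fsubset_trans AI _; apply: fsubsetIr.
(* This independent subset of [S'] has [#|A| + #|D| - #|B|] elements, which is the inequality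
   sought. *)
have : (#|` (A `|` (D `\` B))%fset| <= rk (proj_matroid Eh) S')%N.
  apply: leq_proj_rk; first by rewrite fsubUset AS'.
  by apply: proj_indep_sub iD; rewrite fsubUset AD fsubsetDl.
have dis : [disjoint A & (D `\` B)]%fset.
  apply/fdisjointP => p pA; rewrite inE negb_and negbK.
  by rewrite (fsubsetP AB).
rewrite cardfsU (eqP dis) cardfs0 subn0 cardfsDS //.
move=> cAD; have BDle := fsubset_leq_card BD.
by rewrite addnC -(subnKC BDle) addnCA leq_add2l.
Qed.

End PointMatroid.

(** * Walks: repetitions, reversal, connectivity and circles *)

Lemma dup_split (T U : eqType) (f : T -> U) (s : seq T) : ~~ uniq (map f s) ->
  exists a b s1 s2 s3, f a = f b /\ s = s1 ++ a :: s2 ++ b :: s3.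
Proof.
elim: s => //= a s IHs; rewrite negb_and negbK => /orP[/mapP[b + ab]|/IHs].
  by case/splitPr=> s1 s2; exists a, b, [::], s1, s2.
by case=> x [y [s1 [s2 [s3 [xy ->]]]]]; exists x, y, (a :: s1), s2, s3.
Qed.

Section Walks.
Variables (VT ET : choiceType) (G : graph VT ET).
Implicit Types (u v w : VT) (e : ET) (s t : seq (ET * VT)).

Lemma is_linkC e v w : is_link G e v w -> is_link G e w v.
Proof. by case=> eG vw eE; split=> //; [apply: nesym|rewrite setUC]. Qed.

Lemma is_link_inj e v w v' w' : is_link G e v w -> is_link G e v' w' ->
  (v' = v /\ w' = w) \/ (v' = w /\ w' = v).
Proof. by case=> _ _ eE [_ vw']; rewrite eE => /(set2_eq vw'). Qed.

Lemma walk_cat u s t :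
  walk G u (s ++ t) <-> walk G u s /\ walk G (last u (unzip2 s)) t.
Proof.
elim: s u => [|[e v] s IHs] u /=; first by split=> // -[].
by rewrite IHs; split=> [[? []]|[[]]].
Qed.

Lemma last_unzip2_cat u s t :
  last u (unzip2 (s ++ t)) = last (last u (unzip2 s)) (unzip2 t).
Proof. by rewrite /unzip2 map_cat last_cat. Qed.

Lemma walk_ends u s e : walk G u s -> e \in unzip1 s ->
  ends G e `<=` [set` u :: unzip2 s].
Proof.
elim: s u => [|[e' v] s IHs] u //= [[_ _ eE] ws]; rewrite inE.
case/orP=> [/eqP ->|/(IHs _ ws) es] x; rewrite ?eE /=.
  by case=> ->; rewrite !inE eqxx ?orbT.
by move=> /es /=; rewrite !inE => ->; rewrite orbT.
Qed.

Lemma walk_notin u s e v w : walk G u s -> is_link G e v w ->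
  v \notin u :: unzip2 s -> e \notin unzip1 s.
Proof.
move=> ws [_ _ eE] vs; apply: contraNN vs => es.
by apply: (walk_ends ws es); rewrite eE; left.
Qed.

(** The first edge has the endpoint [u], which the rest of the path never visits, so that edge
    cannot recur. *)
Lemma path_uniq_edges u s :
  walk G u s -> uniq (u :: unzip2 s) -> uniq (unzip1 s).
Proof.
elim: s u => [|[e v] s IHs] u //= [ev ws] /and3P[us vs ss].
by rewrite (walk_notin ws ev us) (IHs v) //= vs.
Qed.

(** A step carries the node it leads to, so reversal pairs each edge with the node it used to leave.
    The reversed walk starts at the old last node. *)
Fixpoint rev_walk u s :=
  if s is (e, v) :: s' then rcons (rev_walk v s') (e, u) else [::].

Lemma unzip1_rev_walk u s : unzip1 (rev_walk u s) = rev (unzip1 s).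
Proof.
elim: s u => [|[e v] s IHs] u //=.
by rewrite rev_cons /unzip1 map_rcons -/(unzip1 _) IHs.
Qed.

Lemma unzip2_rev_walk u s : unzip2 (rev_walk u s) = rev (belast u (unzip2 s)).
Proof.
elim: s u => [|[e v] s IHs] u //=.
by rewrite rev_cons /unzip2 map_rcons -/(unzip2 _) IHs.
Qed.

Lemma last_rev_walk u s :
  last (last u (unzip2 s)) (unzip2 (rev_walk u s)) = u.
Proof. by case: s => [|[e v] s] //=; rewrite /unzip2 map_rcons last_rcons. Qed.

Lemma walk_rev u s : walk G u s -> walk G (last u (unzip2 s)) (rev_walk u s).
Proof.
elim: s u => [|[e v] s IHs] u //= [ev ws].
rewrite -cats1; apply/walk_cat; split; first exact: IHs.
by rewrite last_rev_walk /=; split=> //; apply: is_linkC.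
Qed.

Lemma conn_refl (S : {fset ET}) u : conn G S u u.
Proof. by exists [::]. Qed.

Lemma conn_trans (S : {fset ET}) u v w :
  conn G S u v -> conn G S v w -> conn G S u w.
Proof.
case=> s [ws sS <-] [t [wt tS <-]]; exists (s ++ t); split.
- exact/walk_cat.
- by move=> e; rewrite /unzip1 map_cat mem_cat => /orP[/sS|/tS].
- by rewrite last_unzip2_cat.
Qed.

Lemma conn_sym (S : {fset ET}) u v : conn G S u v -> conn G S v u.
Proof.
case=> s [ws sS <-]; exists (rev_walk u s); split.
- exact: walk_rev.
- by move=> e; rewrite unzip1_rev_walk mem_rev => /sS.
- exact: last_rev_walk.
Qed.

Lemma conn_eq (S : {fset ET}) u v : conn G S u v -> conn G S u = conn G S v.
Proof.
move=> uv; apply/seteqP; split=> w; first exact/conn_trans/conn_sym.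
exact: conn_trans.
Qed.

Lemma conn_link (S : {fset ET}) e u v :
  e \in S -> is_link G e u v -> conn G S u v.
Proof.
by move=> eS ev; exists [:: (e, v)]; split=> // e'; rewrite inE => /eqP ->.
Qed.

Lemma conn_walk (S : {fset ET}) u s v : walk G u s -> {subset unzip1 s <= S} ->
  v \in u :: unzip2 s -> conn G S u v.
Proof.
elim: s u => [|[e x] s IHs] u /=.
  by move=> _ _; rewrite inE => /eqP ->; apply: conn_refl.
move=> [ex ws] sS; rewrite inE => /orP[/eqP ->|vs]; first exact: conn_refl.
apply: conn_trans (conn_link _ ex) (IHs _ ws _ vs).
  by apply: sS; rewrite inE eqxx.
by move=> e' e's; apply: sS; rewrite inE e's orbT.
Qed.

(** The circle follows [s] and returns along [t]. The return visits [belast u (unzip2 t)], so [w] is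
    counted once, from [s], and [u] once, from the return. *)
Lemma theta_traversal u w s t : u <> w -> path_to G u w s -> path_to G u w t ->
  internally_disjoint w s t -> traversal G u (s ++ rev_walk u t).
Proof.
move=> uw [ws ls us] [wt lt ut] [dn de]; split.
- by apply/walk_cat; split=> //; rewrite ls -lt; apply: walk_rev.
- by case: s ls {ws us dn de}.
- by rewrite last_unzip2_cat ls -lt last_rev_walk.
- rewrite /unzip2 map_cat -!/(unzip2 _) unzip2_rev_walk cat_uniq rev_uniq.
  have := us => /= /andP[uNs ->] /=.
  have := ut; rewrite lastI rcons_uniq lt => /andP[wNt ->]; rewrite andbT.
  apply/hasPn => v; rewrite mem_rev => vt; apply/negP => vs.
  have := mem_belast vt; rewrite inE => /orP[/eqP vu|v2].
    by rewrite -vu vs in uNs.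
  by rewrite -(dn v vs v2) vt in wNt.
- rewrite /unzip1 map_cat -!/(unzip1 _) unzip1_rev_walk cat_uniq rev_uniq.
  rewrite (path_uniq_edges ws us) (path_uniq_edges wt ut) andbT /=.
  apply/hasPn => e; rewrite mem_rev => et; apply/negP => es.
  by have := de _ es; rewrite et.
Qed.

(** Views a circle as one link closed up by a path, so that a potential can be built along the path
    and tested on the link. *)
Lemma traversal_cons u s : traversal G u s -> exists e v t,
  [/\ s = (e, v) :: t, is_link G e u v & path_to G v u t].
Proof.
case; case: s => [|[e v] t] //= [ev wt] _ lt ut _.
by exists e, v, t.
Qed.

End Walks.

(** * Gains of walks, potentials and balance *)

Section Gains.
Variables (F : unitRingType) (N E : choiceType) (Phi : gain_graph F N E).
Hypothesis skewF : forall x : F, x != 0 -> x \is a GRing.unit.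
Implicit Types (u v w : N) (e : E) (s t : seq (E * N)) (C : set E).
Implicit Types (h : N -> F).
Local Notation G := (gg_graph Phi).

Lemma walk_gain_cat u s t : walk_gain Phi u (s ++ t) =
  walk_gain Phi u s * walk_gain Phi (last u (unzip2 s)) t.
Proof.
by elim: s u => [|[e v] s IHs] u /=; rewrite ?mul1r // IHs mulrA.
Qed.

Lemma gain_unit e v w : is_link G e v w -> gain Phi e v w \is a GRing.unit.
Proof. by move=> ev; apply/skewF/(gain_neq0 ev). Qed.

Lemma walk_gain_unit u s : walk G u s -> walk_gain Phi u s \is a GRing.unit.
Proof.
elim: s u => [|[e v] s IHs] u /=; first by rewrite unitr1.
by case=> ev ws; rewrite unitrMr ?gain_unit ?IHs.
Qed.

Lemma walk_gain_rev u s : walk G u s ->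
  walk_gain Phi (last u (unzip2 s)) (rev_walk u s) = (walk_gain Phi u s)^-1.
Proof.
elim: s u => [|[e v] s IHs] u /=; first by rewrite invr1.
case=> ev ws; rewrite -cats1 walk_gain_cat last_rev_walk IHs //= mulr1.
by rewrite (gain_inv ev) invrM // ?gain_unit ?walk_gain_unit.
Qed.

Definition potential h C := forall e v w,
  C e -> is_link G e v w -> h v = gain Phi e v w * h w.

(** Opposite gains are inverse, so the equation of a link need only be checked in one direction. *)
Lemma link_potential h e v w : is_link G e v w ->
  h v = gain Phi e v w * h w -> potential h [set e].
Proof.
move=> ev hE _ v' w' -> /(is_link_inj ev)[] [-> ->] //.
by rewrite (gain_inv ev) hE mulKr ?gain_unit.
Qed.

Lemma potential_walk h C u s : potential h C -> walk G u s ->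
  [set` unzip1 s] `<=` C -> h u = walk_gain Phi u s * h (last u (unzip2 s)).
Proof.
move=> hC; elim: s u => [|[e v] s IHs] u /=; first by rewrite mul1r.
case=> ev ws sC; rewrite (hC e u v) //; last by apply: sC; rewrite /= inE eqxx.
rewrite (IHs v) ?mulrA // => e' /= e's.
by apply: sC; rewrite /= inE e's orbT.
Qed.

(** The potential is built backwards from the end of the path, with one forced value for each new
    node. *)
Lemma path_potential u w s : path_to G u w s -> exists h,
  (forall v, h v != 0) /\ potential h [set` unzip1 s].
Proof.
elim: s u => [|[e v] s IHs] u /=.
  by exists (fun=> 1); split=> // v; rewrite oner_eq0.
case=> /= -[ev ws] ls /andP[us vs]; have [//|h [h0 hs]] := IHs v.
(* The first link forces the value at [u]. No later edge has the endpoint [u], so the other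
   equations persist. *)
pose h' x := if x == u then gain Phi e u v * h v else h x.
exists h'; split=> [x|e' x y /=].
  rewrite /h'; case: (x =P u) => // _; apply: contraNneq (h0 v) => gh.
  by rewrite -(mulKr (gain_unit ev) (h v)) gh mulr0.
rewrite inE => /orP[/eqP ->|e's exy].
  apply: link_potential (erefl e); first exact: ev.
  rewrite /h' eqxx; case: (v =P u) => // vu.
  by case: ev => _ /(_ (esym vu)).
have := hs e' x y e's exy; rewrite /h'.
have e'u z : ends G e' z -> z != u.
  by move=> /(walk_ends ws e's) /= zs; apply: contraNneq us => <-.
have [_ _ eE] := exy.
by rewrite !ifN // e'u // eE; [right|left].
Qed.

(** A potential on the path that closes the circle satisfies the equation of the first link because
    the total gain is 1. *)
Lemma traversal_potential u s : traversal G u s -> walk_gain Phi u s = 1 ->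
  exists h, (forall v, h v != 0) /\ potential h [set` unzip1 s].
Proof.
move=> /traversal_cons[e [v [t [-> ev pt]]]] /= gE.
have [h [h0 ht]] := path_potential pt; exists h; split=> // e' x y /=.
rewrite inE => /orP[/eqP ->|]; last exact: ht.
apply: link_potential (erefl e); first exact: ev.
have [wt lt _] := pt.
by rewrite (potential_walk ht wt) // lt mulrA gE mul1r.
Qed.

Lemma potential_closed h C u s : (forall v, h v != 0) -> potential h C ->
  walk G u s -> [set` unzip1 s] `<=` C -> last u (unzip2 s) = u ->
  walk_gain Phi u s = 1.
Proof.
move=> h0 hC ws sC ls; have := potential_walk hC ws sC.
by rewrite ls -{1}[h u]mul1r => /(mulIr (skewF (h0 u))).
Qed.

Lemma balanced_potential C : balanced (gg_bgraph Phi) C ->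
  exists h, (forall v, h v != 0) /\ potential h C.
Proof. by case=> u [s [tr -> gE]]; apply: traversal_potential tr gE. Qed.

(** Balance provides some traversal, with unknown start and direction. The potential removes this
    dependence: it determines the gain of every walk in the circle from its two ends. *)
Lemma balanced_path_gain u w s t :
  balanced (gg_bgraph Phi) [set` unzip1 s ++ unzip1 t] ->
  path_to G u w s -> path_to G u w t -> walk_gain Phi u s = walk_gain Phi u t.
Proof.
move=> /balanced_potential[h [h0 hC]] [ws ls _] [wt lt _].
have sC : [set` unzip1 s] `<=` [set` unzip1 s ++ unzip1 t].
  by move=> e /=; rewrite mem_cat => ->.
have tC : [set` unzip1 t] `<=` [set` unzip1 s ++ unzip1 t].
  by move=> e /=; rewrite mem_cat => ->; rewrite orbT.
have := potential_walk hC ws sC; rewrite (potential_walk hC wt tC) ls lt.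
by move=> /(mulIr (skewF (h0 w))).
Qed.

Lemma gg_biased_graph_axiom : biased_graph_axiom (gg_bgraph Phi).
Proof.
split; first exact: gg_axiom.
  by move=> C [u [s [tr CE _]]]; exists u, s.
move=> u w s1 s2 s3 [uw [p1 p2 p3] [_ _ d13]] b12 b23.
exists u, (s1 ++ rev_walk u s3); split.
- exact: theta_traversal p1 p3 d13.
- apply/seteqP; split=> e /=;
  by rewrite /unzip1 map_cat -!/(unzip1 _) unzip1_rev_walk !mem_cat mem_rev.
- have [w3 l3 _] := p3; have [_ l1 _] := p1.
  rewrite walk_gain_cat l1 -l3 walk_gain_rev // (balanced_path_gain b12 p1 p2).
  by rewrite (balanced_path_gain b23 p2 p3) mulrV ?walk_gain_unit.
Qed.

(** Strong induction on length: a closed subwalk is cut out at a repeated node, and an edge crossed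
    back and forth is cancelled; what remains is empty or a circle. The predicate [P] confines the
    circles to a chosen part of the graph. *)
Lemma closed_walk_gain (P : E -> Prop) u s :
  (forall C, circle G C -> (forall e, C e -> P e) ->
    balanced (gg_bgraph Phi) C) ->
  walk G u s -> (forall e, e \in unzip1 s -> P e) -> last u (unzip2 s) = u ->
  walk_gain Phi u s = 1.
Proof.
move=> bal; have [n] := ubnP (size s).
elim: n s u => // n IHn s u; rewrite ltnS => sn ws sP ls.
have [us2|] := boolP (uniq (unzip2 s)); last first.
  move=> /dup_split[[e x] [[e' y] [s1 [s2 [s3 [/= xy]]]]]].
  rewrite -cat_rcons -(cat_rcons (e', y)) -{}xy => sE.
  have l1 : last u (unzip2 (rcons s1 (e, x))) = x.
    by rewrite /unzip2 map_rcons last_rcons.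
  have l2 : last x (unzip2 (rcons s2 (e', x))) = x.
    by rewrite /unzip2 map_rcons last_rcons.
  (* Both pieces are nonempty: the first makes the closed piece [t2] shorter than [s], the second
     makes [t1 ++ s3] shorter. *)
  have z1 := size_rcons s1 (e, x); have z2 := size_rcons s2 (e', x).
  move: (rcons s1 _) (rcons s2 _) l1 l2 z1 z2 sE => t1 t2 l1 l2 z1 z2 sE.
  move: ws; rewrite sE => /walk_cat[w1 /walk_cat[]]; rewrite l1 l2 => w2 w3.
  move: ls; rewrite sE !last_unzip2_cat l1 l2 => ls.
  have sub e0 :
      e0 \in unzip1 t1 \/ e0 \in unzip1 t2 \/ e0 \in unzip1 s3 -> P e0.
    move=> H; apply: sP; rewrite sE /unzip1 !map_cat !mem_cat.
    by case: H => [->|[] ->]; rewrite ?orbT.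
  move: sn; rewrite sE !size_cat => sn.
  have g2 : walk_gain Phi x t2 = 1.
    apply: IHn => //; last by move=> e0 ?; apply: sub; right; left.
    by apply: leq_trans sn; rewrite z1 addSn ltnS addnCA leq_addr.
  rewrite !walk_gain_cat l1 l2 g2 mul1r -{1}l1 -walk_gain_cat; apply: IHn.
  - by apply: leq_trans sn; rewrite size_cat ltn_add2l z2 addSn ltnS leq_addl.
  - by apply/walk_cat; rewrite l1.
  - move=> e0; rewrite /unzip1 map_cat mem_cat => /orP[] ?; apply: sub.
      by left.
    by right; right.
  - by rewrite last_unzip2_cat l1.
have [us1|] := boolP (uniq (unzip1 s)).
  have [->//|/eqP s0] := eqVneq s [::].
  have tr : traversal G u s by [].
  have [|h [h0 hC]] := @balanced_potential [set` unzip1 s].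
    by apply: bal => //; exists u, s.
  exact: potential_closed h0 hC ws _ ls.
move=> /dup_split[[e w] [[e' x] [s1 [s2 [s3 [/= ee' sE]]]]]].
move: ee' sE us2 ws ls sP sn => <- {e'} -> us2.
move=> /walk_cat[w1 [ew]]; rewrite -/walk => /walk_cat[w2 [ex w3]].
(* Crossing [e] twice in the same direction would repeat the node [w]. In opposite directions, a
   nonempty [s2] would come back to [w]. Hence [s2] is empty and the two gains cancel. *)
case: (is_link_inj ew ex) => -[lE xE].
  move: us2; rewrite /unzip2 map_cat cat_uniq /= map_cat mem_cat xE in_cons.
  by rewrite eqxx orbT /= !andbF.
case: s2 => [|[e2 y] s2] in us2 w2 lE ex w3 *; last first.
  have wy : w \in y :: unzip2 s2 by rewrite -{1}lE /= mem_last.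
  move: us2; rewrite /unzip2 map_cat cat_uniq /= map_cat -cat_cons mem_cat wy.
  by rewrite /= !andbF.
move=> ls sP sn; rewrite walk_gain_cat /= xE in w3 ls *.
rewrite (gain_inv ew) mulVKr ?gain_unit // -walk_gain_cat; apply: IHn.
- by apply: leq_trans sn; rewrite !size_cat /= !addnS ltnS leqnSn.
- by apply/walk_cat.
- move=> e0 H; apply: sP; move: H; rewrite /unzip1 !map_cat !mem_cat /= !inE.
  by case/orP=> ->; rewrite ?orbT.
- by move: ls; rewrite !last_unzip2_cat.
Qed.
End Gains.

(** * Transport of walks, circles and axioms along injective maps *)

Lemma image_injective (T T' : Type) (k : T -> T') :
  injective k -> injective (fun A : set T => k @` A).
Proof.
move=> k_inj A B AB; apply/seteqP; split=> x;
by rewrite -!(image_inj (f := k)) // AB.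
Qed.

Lemma image_seq (T T' : eqType) (k : T -> T') (s : seq T) :
  k @` [set` s] = [set` map k s].
Proof.
apply/seteqP; split=> [_ [x xs <-]|_ /mapP[x xs ->]] /=; first exact: map_f.
by exists x.
Qed.

Section GraphIso.
Variables (VT ET VT' ET' : choiceType).
Variables (G : graph VT ET) (G' : graph VT' ET').
Variables (f : VT -> VT') (g : ET -> ET').
Hypotheses (f_inj : injective f) (g_inj : injective g).
Hypothesis nodesE : nodes G' = f @` nodes G.
Hypothesis edgesE : edges G' = g @` edges G.
Hypothesis endsE : forall e, edges G e -> ends G' (g e) = f @` ends G e.
Implicit Types (s : seq (ET * VT)).

Lemma is_link_iso e v w : is_link G e v w -> is_link G' (g e) (f v) (f w).
Proof.
case=> eG vw eE; split; first by rewrite edgesE; exists e.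
  by move=> /f_inj.
by rewrite endsE // eE image_setU !image_set1.
Qed.

Lemma is_half_iso e v : is_half G e v -> is_half G' (g e) (f v).
Proof.
case=> eG eE; split; first by rewrite edgesE; exists e.
by rewrite endsE // eE image_set1.
Qed.

Lemma is_link_lift e' v' w' : is_link G' e' v' w' -> exists e v w,
  [/\ e' = g e, v' = f v, w' = f w & is_link G e v w].
Proof.
case; rewrite edgesE => -[e eG <-] vw'; rewrite endsE // => eE.
have [[v ev vE] [w ew wE]] : (f @` ends G e) v' /\ (f @` ends G e) w'.
  by rewrite eE; split; [left|right].
exists e, v, w; rewrite vE wE; split=> //; split=> //.
  by move=> vw; apply: vw'; rewrite -vE -wE vw.
by apply: (image_injective f_inj); rewrite eE image_setU !image_set1 vE wE.
Qed.

Definition walk_map s := [seq (g x.1, f x.2) | x <- s].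

Lemma unzip1_walk_map s : unzip1 (walk_map s) = map g (unzip1 s).
Proof. by rewrite /walk_map /unzip1 -!map_comp. Qed.

Lemma unzip2_walk_map s : unzip2 (walk_map s) = map f (unzip2 s).
Proof. by rewrite /walk_map /unzip2 -!map_comp. Qed.

Lemma walk_iso u s : walk G u s -> walk G' (f u) (walk_map s).
Proof.
by elim: s u => [|[e v] s IHs] u //= [ev /IHs]; split=> //; apply: is_link_iso.
Qed.

(** Each step lifts to a link, and injectivity of [f] makes it start at the node already reached. *)
Lemma walk_lift u (s' : seq (ET' * VT')) :
  walk G' (f u) s' -> exists2 s, walk G u s & s' = walk_map s.
Proof.
elim: s' u => [|[e' v'] s' IHs] u /=; first by exists [::].
case=> /is_link_lift[e [u1 [v [-> /f_inj <- -> ev]]]] /IHs[s ws ->].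
by exists ((e, v) :: s).
Qed.

Lemma path_to_lift u w (s' : seq (ET' * VT')) : path_to G' (f u) (f w) s' ->
  exists2 s, path_to G u w s & s' = walk_map s.
Proof.
case=> /walk_lift[s ws ->]; rewrite unzip2_walk_map last_map => /f_inj ls.
by rewrite -map_cons (map_inj_uniq f_inj) => us; exists s.
Qed.

Lemma circle_iso C : circle G' (g @` C) <-> circle G C.
Proof.
split=> [|[u [s [[ws s0 ls us2 us1] ->]]]]; last first.
  exists (f u), (walk_map s); split; last by rewrite unzip1_walk_map image_seq.
  split; rewrite ?unzip1_walk_map ?unzip2_walk_map //.
  - exact: walk_iso.
  - by case: s s0 {ws ls us2 us1}.
  - by rewrite last_map ls.
  - by rewrite (map_inj_uniq f_inj).
  - by rewrite (map_inj_uniq g_inj).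
case=> u' [s' [tr CE]].
(* The start [u'] is not known to be in the image of [f] until the first link is lifted. *)
have [e' [v' [t [_ e'u' _]]]] := traversal_cons tr.
have [_ [u [_ [_ uE _ _]]]] := is_link_lift e'u'.
rewrite uE in tr; case: tr => /walk_lift[s ws s'E]; rewrite {}s'E in CE *.
rewrite unzip1_walk_map unzip2_walk_map last_map.
rewrite (map_inj_uniq f_inj) (map_inj_uniq g_inj).
move=> s0 /f_inj ls us2 us1; exists u, s; split; last first.
  by apply: (image_injective g_inj); rewrite CE unzip1_walk_map image_seq.
by split=> // sE; rewrite sE in s0.
Qed.

Lemma graph_axiom_iso : graph_axiom G -> graph_axiom G'.
Proof.
move=> ax e'; rewrite edgesE => -[e eG <-]; have [eN eE] := ax e eG; split.
  by rewrite endsE // nodesE; apply: image_subset.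
case: eE => [[v /is_half_iso ev]|[v [w /is_link_iso ev]]].
  by left; exists (f v).
by right; exists (f v), (f w).
Qed.

Lemma internally_disjoint_lift w s t :
  internally_disjoint (f w) (walk_map s) (walk_map t) ->
  internally_disjoint w s t.
Proof.
case; rewrite !unzip1_walk_map !unzip2_walk_map => dn de.
split=> [v vs vt|e es].
  by apply: f_inj; apply: dn; apply: map_f.
by have := de _ (map_f g es); rewrite mem_map.
Qed.

End GraphIso.

Lemma biased_graph_axiom_iso (VT ET VT' ET' : choiceType)
    (O : bgraph VT ET) (O' : bgraph VT' ET') (f : VT -> VT') (g : ET -> ET') :
  injective f -> injective g ->
  nodes O' = f @` nodes O -> edges O' = g @` edges O ->
  (forall e, edges O e -> ends O' (g e) = f @` ends O e) ->
  (forall C, balanced O C <-> balanced O' (g @` C)) ->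
  (forall C, balanced O' C -> circle O' C) ->
  biased_graph_axiom O -> biased_graph_axiom O'.
Proof.
move=> f_inj g_inj nodesE edgesE endsE balE balC [ax _ thetaO].
split=> [|//|u' w' s1' s2' s3' [uw' [p1 p2 p3] [d12 d23 d13]] b12 b23].
  exact: graph_axiom_iso nodesE edgesE endsE ax.
(* As [u'] and [w'] differ, the path [s1'] contains a link, whose lift shows that both ends are
   images. *)
have [u [w [uE wE]]] : exists u w, u' = f u /\ w' = f w.
  have [w1 l1 _] := p1.
  case: s1' w1 l1 {p1 d12 d13 b12} => [|[e' v'] s'] /= w1 l1.
    by case: uw'.
  have [/(is_link_lift f_inj edgesE endsE)[e [u [v [_ uE vE _]]]] w1'] := w1.
  rewrite vE in w1' l1.
  have [s ws sE] := walk_lift f_inj edgesE endsE w1'.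
  exists u, (last v (unzip2 s)); split=> //.
  by rewrite -l1 sE unzip2_walk_map last_map.
rewrite {u'}uE {w'}wE in uw' p1 p2 p3 d12 d23 d13.
have [s1 q1 s1E] := path_to_lift f_inj edgesE endsE p1.
have [s2 q2 s2E] := path_to_lift f_inj edgesE endsE p2.
have [s3 q3 s3E] := path_to_lift f_inj edgesE endsE p3.
have imE s t : [set` unzip1 (walk_map f g s) ++ unzip1 (walk_map f g t)] =
    g @` [set` unzip1 s ++ unzip1 t].
  by rewrite image_seq map_cat !unzip1_walk_map.
move: b12 b23 d12 d23 d13; rewrite s1E s2E s3E !imE -!balE => b12 b23.
move=> /(internally_disjoint_lift f_inj g_inj) d12.
move=> /(internally_disjoint_lift f_inj g_inj) d23.
move=> /(internally_disjoint_lift f_inj g_inj) d13.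
apply: (thetaO u w) b12 b23; split=> // uw.
by apply: uw'; rewrite uw.
Qed.

(** Injective images preserve cardinality, union and intersection, so the axioms pull back. The
    frame matroid thus inherits them without any counting of balanced components. *)
Lemma matroid_axiom_iso (T T' : choiceType) (M : rkfun T) (M' : rkfun T')
    (g : T -> T') : injective g ->
  (forall x, ground M x -> ground M' (g x)) ->
  (forall S : {fset T}, rk M' (g @` S)%fset = rk M S) ->
  matroid_axiom M' -> matroid_axiom M.
Proof.
move=> g_inj gM rkE [ax1 ax2 ax3].
have gS (S : {fset T}) : [set` S] `<=` ground M ->
    [set` (g @` S)%fset] `<=` ground M'.
  by move=> SM _ /imfsetP[x xS ->]; apply/gM/SM.
split=> [S SM|S S' SM SS'|S S' SM SM'].
- by rewrite -rkE; apply: leq_trans (ax1 _ (gS _ SM)) _; rewrite card_imfset.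
- by rewrite -!rkE; apply: ax2; [exact: gS|apply/subset_imfset/fsubsetP].
- rewrite -!rkE imfsetU imfsetI => [|x y _ _ /g_inj //].
  by apply: ax3; apply: gS.
Qed.

Lemma range_bij (T T' : Type) (k : T -> T') :
  injective k -> set_bij setT (range k) k.
Proof.
move=> k_inj; split=> [x _|x y _ _ /k_inj //|_ [x _ <-]]; by exists x.
Qed.

(** * Linear functionals and coordinates of node and link points *)

Section Geometry.
Variables (F : unitRingType) (N : choiceType).
Hypothesis skewF : forall x : F, x != 0 -> x \is a GRing.unit.
Implicit Types (u v w : N) (h : N -> F) (x y : {malg F[N]}).

(* Left linear, since the scalars multiply the coefficients on the left. *)
Definition mdot h x : F := \sum_(v <- msupp x) x@_v * h v.

(** Allows vectors with different supports to be summed over a common index set. *)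
Lemma mdotE h x (D : {fset N}) :
  (msupp x `<=` D)%fset -> mdot h x = \sum_(v <- D) x@_v * h v.
Proof.
move=> xD; rewrite /mdot (big_fset_incl _ xD) //= => v _.
by rewrite -mcoeff_eq0 => /eqP ->; rewrite mul0r.
Qed.

Lemma mdotP h a x y : mdot h (a *: x + y) = a * mdot h x + mdot h y.
Proof.
pose D := (msupp x `|` msupp y)%fset.
have xD : (msupp x `<=` D)%fset by apply: fsubsetUl.
have yD : (msupp y `<=` D)%fset by apply: fsubsetUr.
rewrite (mdotE _ xD) (mdotE _ yD) (@mdotE _ _ D); last first.
  apply: fsubset_trans (msuppD_le _ _) _; rewrite fsubUset yD andbT.
  exact: fsubset_trans (msuppZ_le _ _) xD.
rewrite mulr_sumr -big_split /=; apply: eq_bigr => v _.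
by rewrite mcoeffD mcoeffZ mulrDl mulrA.
Qed.

Lemma mdotU h v : mdot h << v >> = h v.
Proof. by rewrite (mdotE _ msuppU_le) big_seq_fset1 mcoeffUU mul1r. Qed.

Lemma mdot_link h v w a : mdot h (<< v >> - a *: << w >>) = h v - a * h w.
Proof. by rewrite addrC -scaleNr mdotP !mdotU mulNr addrC. Qed.

Lemma mdot_ker_subspace h : subspace [set x | mdot h x = 0].
Proof.
split=> [|a x y /= x0 y0]; first by rewrite /= /mdot msupp0 big_seq_fset0.
by rewrite mdotP x0 y0 mulr0 addr0.
Qed.

Lemma malgU_neq0 v : << v >> != 0 :> {malg F[N]}.
Proof. by apply/eqP => /malgP/(_ v)/eqP; rewrite mcoeff0 mcoeffUU oner_eq0. Qed.

Lemma node_pt_point v : is_point (node_pt F v).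
Proof. by exists << v >> => //; apply: malgU_neq0. Qed.

Lemma node_pt_inj : injective (node_pt F (N := N)).
Proof.
move=> v w vw; have : node_pt F v << v >> by apply: sub_pspan.
rewrite vw /node_pt pspan1E => -[c _ /malgP/(_ v)].
rewrite mcoeffZ !mcoeffU eqxx; case: (w =P v) => [//|_] /eqP.
by rewrite mulr0 eq_sym oner_eq0.
Qed.

Lemma node_pts_indep (A : {fset N}) :
  proj_indep [fset node_pt F v | v in A]%fset.
Proof.
apply/proj_indepP => _ /imfsetP[v /= vA ->] vs.
(* The functional of this indicator reads the coordinate at [v], hence kills all other node
   points. *)
pose h w : F := (w == v)%:R.
have : [set x | mdot h x = 0] << v >>.
  apply: (fspan_min (mdot_ker_subspace h) _ (vs _ (sub_pspan (erefl _)))).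
  move=> p; rewrite !inE => /andP[pv /imfsetP[w /= wA pw]]; rewrite pw in pv *.
  apply/pspan1_sub; first exact: mdot_ker_subspace.
  rewrite /= mdotU /h; case: (w =P v) => // wv.
  by rewrite wv eqxx in pv.
by move=> /eqP; rewrite mdotU /h eqxx oner_eq0.
Qed.

(** The link vector has two nonzero coordinates, 1 at [v] and [- a] at [w], whereas a node point has
    at most one. *)
Lemma link_pt_notin v w u a : v <> w -> a != 0 -> link_pt v w a <> node_pt F u.
Proof.
move=> vw a0 E; have : node_pt F u (<< v >> - a *: << w >>).
  by rewrite -E link_ptE //; apply: sub_pspan.
rewrite /node_pt pspan1E => -[c _ /malgP cE].
have := cE v; have := cE w; rewrite !mcoeffB !mcoeffZ !mcoeffU !eqxx.
have [vw1 vw2] : (v == w) = false /\ (w == v) = false.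
  by rewrite [w == v]eq_sym; split; apply/eqP.
rewrite vw1 vw2; case: (u =P v) => [->|_].
  rewrite vw1 !mulr0n mulr0 sub0r mulr1 => /eqP.
  by rewrite eq_sym oppr_eq0 (negPf a0).
by move=> _ /eqP; rewrite !mulr0 subr0 eq_sym oner_eq0.
Qed.

(** Supports are compared: that of the link vector is all of [v], [w], and vectors of the line are
    supported on [v'], [w']. *)
Lemma link_pt_pline v w v' w' a : v <> w -> a != 0 ->
  link_pt v w a `<=` pline (node_pt F v') (node_pt F w') ->
  [set v; w] `<=` [set v'; w'].
Proof.
move=> vw a0; rewrite link_ptE // => /(_ _ (sub_pspan (erefl _))).
rewrite pline_node_ptE => -[b [c /malgP xE]] u uvw.
have : (<< v >> - a *: << w >>)@_u != 0.
  rewrite mcoeffB mcoeffZ !mcoeffU.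
  have [vw1 vw2] : (v == w) = false /\ (w == v) = false.
    by rewrite [w == v]eq_sym; split; apply/eqP.
  case: uvw => ->; rewrite eqxx ?vw1 ?vw2.
    by rewrite mulr0 subr0 oner_eq0.
  by rewrite mulr1 sub0r oppr_eq0.
rewrite xE mcoeffD !mcoeffZ !mcoeffU => {}xE.
have [->|/eqP uv] := v' =P u; first by left.
have [->|/eqP uw] := w' =P u; first by right.
by move: xE; rewrite (negPf uv) (negPf uw) !mulr0 addr0 eqxx.
Qed.

(** The coordinate at [v] forces the proportionality factor to be 1; the coordinate at [w] then
    compares the gains. *)
Lemma link_pt_inj v w (a b : F) :
  v <> w -> link_pt v w a = link_pt v w b -> a = b.
Proof.
move=> vw; rewrite !link_ptE // => E.
have : pspan [set << v >> - b *: << w >>] (<< v >> - a *: << w >>).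
  by rewrite -E; apply: sub_pspan.
rewrite pspan1E => -[c _ /malgP cE].
have := cE v; have := cE w; rewrite !(mcoeffZ, mcoeffB, mcoeffU) !eqxx.
have [-> ->] : (v == w) = false /\ (w == v) = false.
  by rewrite [w == v]eq_sym; split; apply/eqP.
rewrite !mulr0 !mulr1 !sub0r !subr0 mulr1 => + c1; rewrite c1 mul1r.
by move=> /oppr_inj.
Qed.

End Geometry.

(** * Incidence and balance under the passage from edges to points *)

Section Isomorphism.
Variables (F : unitRingType) (N E : choiceType) (Phi : gain_graph F N E).
Hypothesis skewF : forall x : F, x != 0 -> x \is a GRing.unit.
Local Notation G := (gg_graph Phi).
Local Notation Nh := (node_pts F N).
Local Notation Eh := (edge_pts Phi).
Implicit Types (u v w : N) (e : E) (s : seq (E * N)) (S : {fset E}).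
Implicit Types (h : N -> F) (W : set {malg F[N]}).

Lemma half_or_link e :
  (exists v, is_half G e v) \/ (exists v w, is_link G e v w).
Proof. by have [] := @gg_axiom _ _ _ Phi e I. Qed.

Lemma edge_pt_half_sub W e v : subspace W -> is_half G e v ->
  edge_pt Phi e `<=` W <-> W << v >>.
Proof. by move=> sW ev; rewrite (edge_pt_half ev); apply: pspan1_sub. Qed.

Lemma edge_pt_link_sub W e v w : subspace W -> is_link G e v w ->
  edge_pt Phi e `<=` W <-> W (<< v >> - gain Phi e v w *: << w >>).
Proof.
move=> sW ev; rewrite (edge_pt_link skewF ev) link_ptE //; last by case: ev.
exact: pspan1_sub.
Qed.

(** The point of a link is not a node point and lies on only one line joining two node points, so
    its endpoints can be recovered. *)
Lemma edge_pt_ends e : ends (Omega_graph Nh Eh) (edge_pt Phi e) =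
  node_pt F @` ends G e.
Proof.
case: (half_or_link e) => [[v ev]|[v [w ev]]] /=.
  have [_ /= ->] := ev; rewrite (edge_pt_half ev) image_set1.
  apply/seteqP; split=> [p [_ [<-//|[[]]]]|_ ->]; first by exists v.
  by split; [exists v|left].
have [_ vw /= ->] := ev; have g0 := gain_neq0 ev.
rewrite (edge_pt_link skewF ev) image_setU !image_set1.
have lN : ~ Nh (link_pt v w (gain Phi e v w)).
  by case=> u _ /esym; apply: link_pt_notin.
have vwN : node_pt F v <> node_pt F w by move=> /node_pt_inj.
have sub : link_pt v w (gain Phi e v w) `<=` pline (node_pt F v) (node_pt F w).
  rewrite link_ptE // pspan1_sub; last exact: pspan_subspace.
  rewrite pline_node_ptE; exists 1, (- gain Phi e v w).
  by rewrite scale1r scaleNr.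
apply/seteqP; split=> [p [Np [pE|[_ [q [[w' _ <-] pq pqE]]]]]|p].
- by case: lN; rewrite pE.
- case: Np pq pqE => v' _ <- v'w' /(link_pt_pline skewF vw g0) vwS.
  have [] : [set v'; w'] v /\ [set v'; w'] w.
    by split; apply: vwS; [left|right].
  case=> vE [] wE; [|by left; rewrite vE|by right; rewrite wE|];
    by case: vw; rewrite vE wE.
- case=> ->; split; [by exists v| |by exists w|]; right; split=> //.
    by exists (node_pt F w); split=> //; exists w.
  by exists (node_pt F v); split; [exists v|apply/nesym|rewrite plineC].
Qed.

(** The link vectors telescope when each is scaled by the gain of the walk before it. Left scalars
    multiply in the order of traversal, as noncommutativity demands. *)
Lemma walk_span W u s : subspace W -> walk G u s ->
  (forall e, e \in unzip1 s -> edge_pt Phi e `<=` W) ->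
  W (<< u >> - walk_gain Phi u s *: << last u (unzip2 s) >>).
Proof.
move=> sW; elim: s u => [|[e v] s IHs] u /=.
  by move=> _ _; rewrite scale1r subrr; case: sW.
case=> ev ws eW; set l := last _ _; set g := gain _ _ _ _.
have -> : << u >> - (g * walk_gain Phi v s) *: << l >> =
  g *: (<< v >> - walk_gain Phi v s *: << l >>) + (<< u >> - g *: << v >>).
  by rewrite scalerBr scalerA [RHS]addrC addrA subrK.
case: (sW) => _; apply.
  by apply: IHs => // e' e's; apply: eW; rewrite inE e's orbT.
by apply/(edge_pt_link_sub sW ev); apply: eW; rewrite inE eqxx.
Qed.

(** A potential puts no condition on half edges, so vanishing at their nodes is asked for
    separately. *)
Lemma potential_ker h C e : potential Phi h C -> C e ->
  (forall v, is_half G e v -> h v = 0) ->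
  edge_pt Phi e `<=` [set x | mdot h x = 0].
Proof.
move=> hC Ce hh; have sk := mdot_ker_subspace h.
case: (half_or_link e) => [[v ev]|[v [w ev]]].
  by apply/(edge_pt_half_sub sk ev); rewrite /= mdotU hh.
by apply/(edge_pt_link_sub sk ev); rewrite /= mdot_link (hC e v w) // subrr.
Qed.

Lemma walk_not_half u s e v : walk G u s -> e \in unzip1 s -> ~ is_half G e v.
Proof.
elim: s u => [|[e' w] s IHs] u //= [[_ uw eE] ws]; rewrite inE.
case/orP=> [/eqP ->|es]; last exact: IHs ws es.
by case=> _; rewrite eE => /esym /(set1_neq2 uw).
Qed.

Hypothesis edge_pt_inj : injective (edge_pt Phi).

Lemma circle_edge_pt C :
  circle (Omega_graph Nh Eh) (edge_pt Phi @` C) <-> circle G C.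
Proof.
apply: (circle_iso (@node_pt_inj F N) edge_pt_inj) => // e _.
exact: edge_pt_ends.
Qed.

Lemma balanced_edge_pt C :
  balanced (gg_bgraph Phi) C <-> balanced (Omega Nh Eh) (edge_pt Phi @` C).
Proof.
split=> [bC|[/circle_edge_pt[u [s [tr CE]]] [W [sW WN WC]]]].
  have cC : circle G C by case: bC => u [s [tr CE _]]; exists u, s.
  split; first exact/circle_edge_pt.
  have [h [h0 hC]] := balanced_potential skewF bC.
  have sk := mdot_ker_subspace h.
  (* This kernel avoids every node point because [h] vanishes nowhere. *)
  exists [set x | mdot h x = 0]; split=> //.
    move=> _ [v _ <-] /(pspan1_sub _ sk) /=; rewrite mdotU.
    by move/eqP; rewrite (negPf (h0 v)).
  move=> _ [e Ce <-]; apply: (potential_ker hC) => // v ev.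
  have [u [s [[ws _ _ _ _] CE]]] := cC; rewrite CE in Ce.
  by case: (walk_not_half ws Ce ev).
exists u, s; split=> //; have [ws _ ls _ _] := tr.
have : W (<< u >> - walk_gain Phi u s *: << last u (unzip2 s) >>).
  by apply: walk_span => // e es; apply: WC; exists e; rewrite // CE.
rewrite ls -{1}[<< u >>]scale1r -scalerBl => WE.
(* If the gain were not 1, dividing by [1 - walk_gain Phi u s] would put the node point of [u] into
   [W]. *)
apply: contrapT => /eqP; rewrite eq_sym -subr_eq0 => g0.
apply: (WN (node_pt F u)); first by exists u.
exact/(pspan1_sub _ sW)/(subspaceZ_unit skewF sW g0 WE).
Qed.

Lemma edge_pt_biased_graph_iso : biased_graph_iso (gg_bgraph Phi) (Omega Nh Eh)
  (node_pt F) (edge_pt Phi).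
Proof.
split.
- split; first exact: gg_biased_graph_axiom.
  apply: (biased_graph_axiom_iso (O := gg_bgraph Phi) (f := node_pt F)
    _ edge_pt_inj) => //.
  + exact: node_pt_inj.
  + by move=> e _; apply: edge_pt_ends.
  + exact: balanced_edge_pt.
  + by move=> C [].
  + exact: gg_biased_graph_axiom.
- exact/range_bij/node_pt_inj.
- exact: range_bij.
- by move=> e _; apply: edge_pt_ends.
- by move=> C _; apply: balanced_edge_pt.
Qed.

End Isomorphism.

(** * Components, their spans, and equality of the two rank functions *)

Section Rank.
Variables (F : unitRingType) (N E : choiceType) (Phi : gain_graph F N E).
Hypothesis skewF : forall x : F, x != 0 -> x \is a GRing.unit.
Local Notation G := (gg_graph Phi).
Implicit Types (u v w : N) (e : E) (s : seq (E * N)) (S : {fset E}).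
Implicit Types (h : N -> F) (W : set {malg F[N]}).

(** Modulo [W], the unit vector of [v] is the multiple of that of [w] by the gain of a connecting
    walk. *)
Lemma conn_span W S v w : subspace W ->
  (forall e, e \in S -> edge_pt Phi e `<=` W) ->
  conn G S v w -> W << w >> -> W << v >>.
Proof.
move=> sW SW [s [ws sS <-]] Ww.
have := walk_span skewF sW ws (fun e es => SW e (sS e es)).
move=> /(subspaceD sW)/(_ (subspaceZ (walk_gain Phi v s) sW Ww)).
by rewrite subrK.
Qed.

(** By contraposition: a half edge of the component, or a circle of gain other than 1, would put
    some node of the component into [W], and connectivity would carry this to [v]. *)
Lemma unbalanced_span W S v : subspace W ->
  (forall e, e \in S -> edge_pt Phi e `<=` W) -> node_set G S v ->
  ~ balanced_component (gg_bgraph Phi) S (conn G S v) -> W << v >>.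
Proof.
move=> sW SW Sv; apply: contra_notP => Wv; split.
- by exists v.
- move=> e w eS ew vw; apply: Wv; apply: (conn_span sW SW vw).
  exact/(edge_pt_half_sub sW ew)/SW.
move=> C [u [s [tr ->]]] CS CK; exists u, s; split=> //.
have [e [x [t [sE [_ _ eE] _]]]] := traversal_cons tr.
have vu : conn G S v u.
  apply: (CK e); first by rewrite sE /= inE eqxx.
  by rewrite eE; left.
have [ws _ ls _ _] := tr.
have := walk_span skewF sW ws (fun e es => SW e (CS e es)).
rewrite ls -{1}[<< u >>]scale1r -scalerBl => Wu.
apply: contrapT => /eqP; rewrite eq_sym -subr_eq0 => g0; apply: Wv.
exact/(conn_span sW SW vu)/(subspaceZ_unit skewF sW g0 Wu).
Qed.

(** The value 1 at [v] forces the inverse of the gain of a walk from [v] at each node of the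
    component. The choice of walk is immaterial because closed walks at [v] have gain 1. *)
Lemma balanced_component_potential S v :
  balanced_component (gg_bgraph Phi) S (conn G S v) ->
  exists h, [/\ h v = 1, forall w, ~ conn G S v w -> h w = 0 &
    forall e, e \in S -> edge_pt Phi e `<=` [set x | mdot h x = 0]].
Proof.
case=> _ halfK circK.
have closed1 s : walk G v s -> {subset unzip1 s <= S} ->
    last v (unzip2 s) = v -> walk_gain Phi v s = 1.
  move=> ws sS ls.
  (* Balance is known only for circles inside the component, so [P] records the endpoints as well as
     membership in [S]. *)
  pose P e := e \in S /\ ends G e `<=` conn G S v.
  apply: (closed_walk_gain skewF (P := P)) ls => //.
    by move=> C cC CP; apply: circK => // e Ce; have [] := CP e Ce.
  move=> e es; split; first exact: sS.
  by move=> x /(walk_ends ws es) /(conn_walk ws sS).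
have /choice[a aP] : forall w, exists c : F, conn G S v w ->
    exists s, [/\ walk G v s, {subset unzip1 s <= S}, last v (unzip2 s) = w &
      c = (walk_gain Phi v s)^-1].
  move=> w; have [[s [ws sS ls]]|nvw] := pselect (conn G S v w); last first.
    by exists 0.
  by exists (walk_gain Phi v s)^-1 => _; exists s.
(* The value 0 elsewhere kills the half edges of [S], none of which is in this component, and the
   node points of other components. *)
pose h w := if `[< conn G S v w >] then a w else 0.
exists h; split.
- rewrite /h asboolT; last exact: conn_refl.
  have [s [ws sS ls ->]] := aP v (conn_refl _ _ _).
  by rewrite closed1 // invr1.
- by move=> w vw; rewrite /h asboolF.
move=> e eS; apply: (potential_ker skewF (C := [set` S])) => //; last first.
  by move=> x ex; rewrite /h asboolF //; apply: halfK ex.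
move=> {eS} {}e x y /= eS exy; have xy := conn_link eS exy.
have [vx|nvx] := pselect (conn G S v x); last first.
  rewrite /h !asboolF ?mulr0 // => vy; apply: nvx.
  exact: conn_trans vy (conn_sym xy).
have vy := conn_trans vx xy; rewrite /h !asboolT //.
have [s [ws sS ls ->]] := aP x vx; have [t [wt tS lt ->]] := aP y vy.
(* Out to [x] by its chosen walk, across [e], and back from [y] along the reverse of its own: gain 1
   here is the equation of [e]. *)
have : walk_gain Phi v (s ++ (e, y) :: rev_walk v t) = 1.
  apply: closed1.
  - apply/walk_cat; rewrite ls; split=> //; split=> //.
    by rewrite -lt; apply: walk_rev.
  - move=> e'; rewrite /unzip1 map_cat mem_cat => /orP[/sS //|/=].
    by rewrite inE -/(unzip1 _) unzip1_rev_walk mem_rev => /orP[/eqP -> //|/tS].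
  - by rewrite last_unzip2_cat /= -lt last_rev_walk.
rewrite walk_gain_cat /= ls -lt walk_gain_rev // lt => g1.
by rewrite -[RHS](mulKr (walk_gain_unit skewF ws)) g1 mulr1.
Qed.

(** Finiteness gives [fset_set] its intended meaning in the frame rank. *)
Lemma finite_node_set S : finite_set (node_set G S).
Proof.
have -> : node_set G S = \bigcup_(e in [set` S]) ends G e.
  by apply/seteqP; split=> v [e eS ev]; exists e.
apply: bigcup_finite => // e _.
by case: (half_or_link Phi e) => [[v [_ ->]]|[v [w [_ _ ->]]]].
Qed.

Lemma finite_balanced_component S :
  finite_set (balanced_component (gg_bgraph Phi) S).
Proof.
apply: sub_finite_set (_ : _ `<=` components G S) _; first by move=> K [].
exact/finite_image/finite_node_set.
Qed.

Lemma proj_rk_edge_pt (Eh : set (set {malg F[N]})) S :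
  rk (proj_matroid Eh) [fset edge_pt Phi e | e in S]%fset =
  rk (frame_matroid (gg_bgraph Phi)) S.
Proof.
set Sh := [fset _ | _ in _]%fset.
have ptS p : p \in Sh -> is_point p.
  by move=> /imfsetP[e _ ->]; apply: edge_pt_point.
have [T bT _] := proj_basis_ext skewF ptS (fsub0set _) (@proj_indep0 _ _).
rewrite (proj_rk_basis skewF Eh ptS bT) /=; have [TS iT ST] := bT.
set Bal := balanced_component _ S.
set NS := fset_set _; set BS := fset_set _.
have NSP v : (v \in NS) <-> node_set G S v.
  by rewrite in_fset_set ?inE //; apply: finite_node_set.
have BSP K : (K \in BS) <-> Bal K.
  by rewrite in_fset_set ?inE //; apply: finite_balanced_component.
(* One node point is chosen for each balanced component; [set0] is a default off the balanced
   components. *)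
have /choice[r rP] : forall K, exists p : set {malg F[N]}, Bal K ->
    exists v, [/\ node_set G S v, K = conn G S v & p = node_pt F v].
  move=> K; have [bK|] := pselect (Bal K); last by exists set0.
  by have [[v Sv <-] _ _] := bK; exists (node_pt F v) => _; exists v.
pose R := [fset r K | K in BS]%fset.
have cR : #|` R| = #|` BS|.
  apply: card_in_imfset => K K' /BSP/rP[v [_ -> ->]] /BSP/rP[w [_ -> ->]].
  by move=> /node_pt_inj ->.
have RP p : p \in R -> exists v,
    [/\ node_set G S v, Bal (conn G S v), p = node_pt F v & p = r (conn G S v)].
  move=> /imfsetP[K /= /BSP bK ->]; have [v [Sv KE rE]] := rP K bK.
  by exists v; rewrite -KE.
(* The functional of the component of [p] is 1 at the node of [p], but kills the points of [S] and
   the representatives of the other balanced components. *)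
have RN p : p \in R -> ~ p `<=` fspan (T `|` (R `\ p))%fset.
  move=> pR psub; have [v [Sv bv pE prE]] := RP p pR.
  have [h [hv h0 hS]] := balanced_component_potential bv.
  have sk := mdot_ker_subspace h.
  have : [set x | mdot h x = 0] << v >>.
    apply: (fspan_min sk _ (psub _ _)); last by rewrite pE; apply: sub_pspan.
    move=> q; rewrite !inE => /orP[/(fsubsetP TS) /imfsetP[e eS ->]|].
      exact: hS.
    move=> /andP[qp /RP[w [_ _ qE qrE]]]; rewrite qE.
    apply/(pspan1_sub _ sk); rewrite /= mdotU; apply: h0 => /conn_eq vw.
    by rewrite prE vw -qrE eqxx in qp.
  by move=> /eqP; rewrite mdotU hv oner_eq0.
have ptT p : p \in T -> is_point p by move=> /(fsubsetP TS) /ptS.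
have ptR p : p \in R -> is_point p.
  by move=> /RP[v [_ _ -> _]]; apply: node_pt_point.
have iTR : proj_indep (T `|` R)%fset.
  suff iTA A : (A `<=` R)%fset -> proj_indep (T `|` A)%fset by exact: iTA.
  (* The representatives join the independent set [T] one at a time, each outside the current span
     by [RN]. *)
  elim/fset1U_rect: A => [|p A pA IHA]; first by rewrite fsetU0.
  rewrite fsubUset fsub1set => /andP[pR AR].
  rewrite fsetUCA; apply: proj_indep1U; [exact: skewF|exact: ptR| |exact: IHA|].
    by move=> q; rewrite inE => /orP[/ptT|/(fsubsetP AR) /ptR].
  move=> pTA; apply: (RN p pR); apply: (subset_trans pTA); apply: fspanS.
  apply: fsetUS; apply/fsubsetP => q qA; rewrite !inE (fsubsetP AR) // andbT.
  by apply: contraNneq pA => <-.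
have cTR : #|` (T `|` R)%fset| = (#|` T| + #|` BS|)%N.
  rewrite cardfsU -cR.
  suff -> : (T `&` R)%fset = fset0 by rewrite cardfs0 subn0.
  apply/fsetP => p; rewrite !inE; apply/negP => /andP[pT pR].
  by apply: (RN p pR); apply: sub_fspan; rewrite inE pT.
pose Nh := [fset node_pt F v | v in NS]%fset.
have cN : #|` Nh| = #|` NS| by apply: card_imfset; apply: node_pt_inj.
have ptN p : p \in Nh -> is_point p.
  by move=> /imfsetP[v _ ->]; apply: node_pt_point.
have ptTR p : p \in (T `|` R)%fset -> is_point p.
  by rewrite inE => /orP[/ptT|/ptR].
have NhU v : node_set G S v -> fspan Nh << v >>.
  move=> /NSP vS; apply: (@sub_fspan _ _ _ (node_pt F v)).
    exact: in_imfset.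
  exact: sub_pspan.
have sN := fspan_subspace Nh.
have SW e : e \in S -> edge_pt Phi e `<=` fspan (T `|` R)%fset.
  move=> eS; apply: (subset_trans (ST _ _)); first exact: in_imfset.
  by apply: fspanS; apply: fsubsetUl.
have sW := fspan_subspace (T `|` R)%fset.
(* The frame rank is a truncated difference, so it is computed from this sum. *)
suff -> : #|` NS| = (#|` T| + #|` BS|)%N by rewrite addnK.
rewrite -cN -cTR; apply/eqP; rewrite eqn_leq; apply/andP; split.
  apply: proj_indep_card_le => //; first exact: node_pts_indep.
  (* A node of a balanced component is reached from its representative, any other node by
     [unbalanced_span]. *)
  move=> _ /imfsetP[v /= /NSP Sv ->]; apply/(pspan1_sub _ sW).
  have [bv|] := pselect (Bal (conn G S v)); last exact: unbalanced_span.
  have [w [Sw cE rE]] := rP _ bv.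
  apply: (conn_span sW SW (w := w)).
    by rewrite cE; apply: conn_refl.
  apply: (@sub_fspan _ _ _ (node_pt F w)); last exact: sub_pspan.
  by rewrite inE -rE; apply/orP; right; apply: in_imfset; apply/BSP.
(* Conversely, edges of [S] and representatives lie in the span of the nodes of [S]. *)
apply: proj_indep_card_le => // p; rewrite inE.
case/orP=> [|/RP[v [Sv _ -> _]]]; last first.
  by apply/(pspan1_sub _ sN); apply: NhU.
move=> /(fsubsetP TS) /imfsetP[e /= eS ->].
case: (half_or_link Phi e) => [[v ev]|[v [w ev]]].
  apply/(edge_pt_half_sub sN ev); apply: NhU; exists e => //.
  by case: ev => _ ->.
have [_ _ eE] := ev; apply/(edge_pt_link_sub skewF sN ev).
rewrite addrC -scaleNr; case: (sN) => _.
by apply; apply: NhU; exists e => //; rewrite eE; [right|left].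
Qed.

End Rank.

(** * Injectivity of the edge map and the two isomorphisms *)

Theorem theorem2p6 (F : unitRingType)
    (skewF : forall x : F, x != 0 -> x \is a GRing.unit)
    (N E : choiceType) (Phi : gain_graph F N E)
    (links_simple : forall (e f : E) (v w : N),
        is_link (gg_graph Phi) e v w -> is_link (gg_graph Phi) f v w ->
        gain Phi e v w = gain Phi f v w -> e = f)
    (halves_simple : forall (e f : E) (v : N),
        is_half (gg_graph Phi) e v -> is_half (gg_graph Phi) f v -> e = f) :
  biased_graph_iso (gg_bgraph Phi) (Omega (node_pts F N) (edge_pts Phi))
    (node_pt F) (edge_pt Phi) /\
  matroid_iso (frame_matroid (gg_bgraph Phi)) (proj_matroid (edge_pts Phi))
    (edge_pt Phi).
Proof.
have edge_pt_inj : injective (edge_pt Phi).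
  move=> e f ef.
  (* The point determines the endpoints; what is left is to separate half edges at one node and
     links with the same ends, the latter by their gains. *)
  have efE : ends (gg_graph Phi) e = ends (gg_graph Phi) f.
    apply: (image_injective (@node_pt_inj F N)).
    by rewrite -!(edge_pt_ends _ skewF) ef.
  case: (half_or_link Phi e) => [[v ev]|[v [w ev]]].
    exact: (halves_simple e f v ev (conj I (etrans (esym efE) ev.2))).
  have [_ vw eE] := ev.
  have fv : is_link (gg_graph Phi) f v w := And3 I vw (etrans (esym efE) eE).
  apply: (links_simple e f v w ev fv); apply: (link_pt_inj skewF vw).
  rewrite -(edge_pt_link skewF ev) -(edge_pt_link skewF fv); exact: ef.
have ax : matroid_axiom (proj_matroid (edge_pts Phi)).
  by apply: proj_matroid_axiom => // _ [e _ <-]; apply: edge_pt_point.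
split; first exact: edge_pt_biased_graph_iso.
split.
- split=> //; apply: (matroid_axiom_iso edge_pt_inj) ax => [e _|S].
    by exists e.
  exact: proj_rk_edge_pt.
- exact: range_bij.
- by move=> S _; apply: proj_rk_edge_pt.
Qed.
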